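(* Let $V$ be a finite dimensional real Hilbert space. Then $V$ admits a cross product if and only if its dimension is either $0$, $1$, $3$, or $7$. In dimensions $0$ and $1$ the cross product vanishes, in dimension $3$ it is unique up to sign and determined by an orientation of $V$, and in dimension $7$ it is unique up to orthogonal isomorphism.
   Context: Let $V$ be a finite dimensional real Hilbert space with inner product $\langle\cdot,\cdot\rangle$ and norm $|\cdot|$. A skew-symmetric bilinear map $V\times V\to V$, $(u,v)\mapsto u\times v$, is called a cross product if $\langle u\times v,u\rangle=\langle u\times v,v\rangle=0$ and $|u\times v|^2=|u|^2|v|^2-\langle u,v\rangle^2$ for all $u,v\in V$. *)

(* Defs.v *)
From HB Require Import structures.
From mathcomp Require Import all_boot all_order all_algebra sesquilinear.
From mathcomp Require Import classical_sets reals.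

Set Implicit Arguments.
Unset Strict Implicit.
Unset Printing Implicit Defensive.

Import Order.TTheory GRing.Theory Num.Theory.
Local Open Scope ring_scope.

(* A finite dimensional real Hilbert space is a [V : vectType R] with an inner
   product [dot : {dot V for idfun}], that is, a symmetric bilinear form with
   0 < dot u u whenever u != 0. Completeness is automatic. *)

Definition dot_norm (R : realType) (V : vectType R) (dot : {dot V for idfun})
    (u : V) : R := Num.sqrt (dot u u).

Definition is_cross_product (R : realType) (V : vectType R)
    (dot : {dot V for idfun}) (cross : {bilinear V -> V -> V}) : Prop :=
  [/\ forall u v, cross u v = - cross v u,
      forall u v, dot (cross u v) u = 0 /\ dot (cross u v) v = 0
    & forall u v, dot_norm dot (cross u v) ^+ 2
        = dot_norm dot u ^+ 2 * dot_norm dot v ^+ 2 - dot u v ^+ 2].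

(* Row j holds the coordinates of the j-th vector of b' in the basis b. *)
Definition basis_change (R : realType) (V : vectType R) (n : nat)
    (b b' : n.-tuple V) : 'M[R]_n :=
  \matrix_(j, i) coord b i (tnth b' j).

(* An orientation is a class of ordered bases, two bases being equivalent when
   the change of basis has positive determinant. This is the usual notion for
   n > 0; it is only used for n = 3. *)
Definition is_orientation (R : realType) (V : vectType R) (n : nat)
    (O : set (n.-tuple V)) : Prop :=
  exists2 b : n.-tuple V, basis_of fullv b &
    forall b' : n.-tuple V,
      O b' <-> basis_of fullv b' /\ 0 < \det (basis_change b b').

(* The right-hand rule. *)
Definition induces_cross (R : realType) (V : vectType R)
    (O : set (3.-tuple V)) (cross : V -> V -> V) : Prop :=
  forall u v, free [:: u; v] -> O [tuple u; v; cross u v].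

(* Main.v *)
Require Import Defs.
From HB Require Import structures.
From mathcomp Require Import all_boot all_order all_algebra sesquilinear.
From mathcomp Require Import classical_sets reals.
From mathcomp Require Import ring.

Set Implicit Arguments.
Unset Strict Implicit.
Unset Printing Implicit Defensive.

Import Order.TTheory GRing.Theory Num.Theory.
Local Open Scope ring_scope.

(** A cross product makes every operator u × _, with u a unit vector, square to
    -1 on the orthogonal complement of u ([cross_cross]). Polarizing in u, the
    operators of two orthogonal vectors anticommute away from their span, so
    that u × (v × w) is alternating on triples of orthogonal vectors
    ([crossCA]). All the rest is computed from this identity in orthonormal
    frames.

    Dimension. Two orthonormal vectors i, j give a third one, i × j. If this
    does not exhaust V, a unit vector e orthogonal to these three doubles them
    to seven orthonormal vectors i, j, i × j, e, e × i, e × j, e × (i × j):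
    this is the Cayley-Dickson step from quaternions to octonions. If V were
    larger still, a unit vector f orthogonal to all seven would allow
    (f × i) × (e × j) to be computed in two ways, as X and as -X for the unit
    vector X = f × (e × (i × j)) ([no_octonion_extension]). Hence the
    dimension is 0, 1, 3 or 7 ([cross_dim]).

    Existence. In an orthonormal basis, put e_i × e_j = e_k along the cyclic
    rotations (i, j, k) of a list of oriented lines: none in dimensions 0 and
    1, one in dimension 3, and the seven lines of the Fano plane in dimension
    7. The norm identity is then a polynomial identity in the coordinates
    ([table_crossP]).

    Uniqueness. Any two basis vectors lie on a common line, hence the products
    along the lines determine the whole cross product ([cross_transfer]). In
    dimension 7 every cross product has a frame following the same seven
    lines, and the isometry carrying one frame to the other is the required
    isomorphism. In dimension 3 only the sign of i × j is free.

    Orientation. In dimension 3 the trilinear form (u × v) . w is the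
    determinant of u, v, w in the frame i, j, i × j
    ([det_basis_change_cross]); for independent u and v it is positive at
    w = u × v, so that all bases u, v, u × v are oriented like that frame. *)

(** * Inner products and orthonormal families *)

Section InnerProduct.
Variables (R : realType) (V : vectType R) (dot : {dot V for idfun}).
Implicit Types (u v w x : V) (a : R) (s : seq V).

Lemma dotC u v : dot u v = dot v u.
Proof. by rewrite hermC mul1r. Qed.

Lemma dotDl u v w : dot (u + v) w = dot u w + dot v w.
Proof. exact: linearDl. Qed.

Lemma dotBl u v w : dot (u - v) w = dot u w - dot v w.
Proof. exact: linearBl. Qed.

Lemma dotNl u v : dot (- u) v = - dot u v.
Proof. exact: linearNl. Qed.

Lemma dot0l u : dot 0 u = 0.
Proof. exact: linear0l. Qed.

Lemma dotZl a u v : dot (a *: u) v = a * dot u v.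
Proof. exact: linearZl_LR. Qed.

Lemma dot_suml I r (P : pred I) (F : I -> V) v :
  dot (\sum_(i <- r | P i) F i) v = \sum_(i <- r | P i) dot (F i) v.
Proof. exact: linear_sumlz. Qed.

Lemma dotDr u v w : dot u (v + w) = dot u v + dot u w.
Proof. exact: linearDr. Qed.

Lemma dotNr u v : dot u (- v) = - dot u v.
Proof. exact: linearNr. Qed.

Lemma dotZr a u v : dot u (a *: v) = a * dot u v.
Proof. exact: linearZr_LR. Qed.

Lemma dot_gt0 u : u != 0 -> 0 < dot u u.
Proof. exact: neq0_dnorm_gt0. Qed.

Lemma dot_ge0 u : 0 <= dot u u.
Proof. by have [->|/dot_gt0/ltW//] := eqVneq u 0; rewrite dot0l. Qed.

Lemma dot_eq0 u : (dot u u == 0) = (u == 0).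
Proof.
have [->|/dot_gt0 u0] := eqVneq u 0; first by rewrite dot0l eqxx.
by rewrite gt_eqF.
Qed.

Lemma dot_inj u v : (forall w, dot u w = dot v w) -> u = v.
Proof.
by move=> uv; apply/eqP; rewrite -subr_eq0 -dot_eq0 dotBl uv subrr.
Qed.

Lemma sqr_dot_norm u : dot_norm dot u ^+ 2 = dot u u.
Proof. by rewrite sqr_sqrtr// dot_ge0. Qed.

Lemma nth_orthonormal s i j : orthonormal dot s ->
  (i < size s)%N -> (j < size s)%N -> dot s`_i s`_j = (i == j)%:R.
Proof.
case/andP; elim: s i j => [//|x s IH] [|i] [|j] //=.
- by case/andP=> /eqP-> _ _.
- move=> _ /andP[/andP[/allP xs _] _] _ js.
  by have /eqP := xs _ (mem_nth 0 js).
- move=> _ /andP[/andP[/allP xs _] _] is_ _.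
  by rewrite dotC; have /eqP := xs _ (mem_nth 0 is_).
- by move=> /andP[_ s1] /andP[_ os]; apply: IH.
Qed.

Lemma orthonormal_cat s1 s2 : orthonormal dot s1 -> orthonormal dot s2 ->
  (forall x y, x \in s1 -> y \in s2 -> dot x y = 0) -> orthonormal dot (s1 ++ s2).
Proof.
elim: s1 => [//|x s1 IH] /= /andP[/= /andP[x1 s11] /andP[/andP[xs1 _] os1]] os2 s12.
have /andP[s1s2 os1s2] : orthonormal dot (s1 ++ s2).
  apply: IH => //; first by rewrite /orthonormal s11.
  by move=> y z ys zs; rewrite s12// inE ys orbT.
rewrite /orthonormal /= x1 s1s2 os1s2 !andbT all_cat xs1 /=.
by apply/allP => y ys; rewrite /= s12// mem_head.
Qed.

Lemma orthonormal_map (f : V -> V) s :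
  (forall x y, x \in s -> y \in s -> dot (f x) (f y) = dot x y) ->
  orthonormal dot (map f s) = orthonormal dot s.
Proof.
move=> fs; rewrite /orthonormal all_map; congr andb.
  by apply: eq_in_all => x xs; rewrite /= fs.
elim: s fs => //= x s IH fs; rewrite IH => [|y z ys zs]; last first.
  by rewrite fs// inE ?ys ?zs orbT.
congr andb; rewrite !andbT all_map; apply: eq_in_all => y ys.
by rewrite /= fs ?mem_head// inE ys orbT.
Qed.

Lemma orthonormal_rcons s x : orthonormal dot s -> dot x x = 1 ->
  (forall y, y \in s -> dot x y = 0) -> orthonormal dot (rcons s x).
Proof.
move=> os x1 xs; rewrite -cats1; apply: orthonormal_cat => //.
  by rewrite /orthonormal /= x1 eqxx.
by move=> y z /xs + /[!inE] /eqP ->; rewrite dotC.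
Qed.

Lemma orthonormal_free s : orthonormal dot s -> free s.
Proof.
move=> os; rewrite -(in_tupleE s); apply/freeP => k sk0 i.
have := congr1 (dot^~ s`_i) sk0; rewrite dot0l dot_suml (bigD1 i)//= big1 => [|j ji].
  by rewrite dotZl nth_orthonormal// eqxx mulr1 addr0.
by rewrite dotZl nth_orthonormal// (inj_eq val_inj) (negPf ji) mulr0.
Qed.

Lemma free_size_leq s : free s -> (size s <= \dim {:V})%N.
Proof. by move=> /eqP <-; apply/dimvS/subvf. Qed.

(** The inner products with the members of s are size s linear equations in
    dim V unknowns, so that they have a nonzero common solution. *)
Lemma exists_unit_orthogonal s : (size s < \dim {:V})%N ->
  exists2 x, dot x x = 1 & forall y, y \in s -> dot x y = 0.
Proof.
move=> sV; pose f (x : V) := \row_(i < size s) dot x s`_i.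
have f_lin : linear f.
  by move=> a x y; apply/rowP => i; rewrite !mxE dotDl dotZl.
pose fL := GRing.isLinear.Build _ _ _ _ f f_lin.
pose g := linfun (HB.pack f fL : {linear V -> 'rV_(size s)}).
have g_ker : lker g != 0%VS.
  apply: contraTneq sV => g0; have := limg_ker_dim g fullv.
  rewrite g0 capv0 dimv0 add0n -leqNgt => <-.
  by apply: (leq_trans (dimvS (subvf _))); rewrite dimvf dim_matrix mul1r leqnn.
pose x := vpick (lker g); have /dot_gt0 xx : x != 0 by rewrite vpick0.
exists ((Num.sqrt (dot x x))^-1 *: x) => [|y /(nthP 0)[i si <-]].
  rewrite dotZl dotZr mulrA -expr2 exprVn sqr_sqrtr ?dot_ge0//.
  by rewrite mulVf// gt_eqF.
have : g x = 0 by apply/eqP; rewrite -memv_ker memv_pick.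
rewrite lfunE => /rowP /(_ (Ordinal si)); rewrite !mxE dotZl /= => ->.
by rewrite mulr0.
Qed.

Lemma exists_orthonormal n : (n <= \dim {:V})%N ->
  exists2 s, size s = n & orthonormal dot s.
Proof.
elim: n => [|n IH] nV; first by exists [::].
have [s sn os] := IH (ltnW nV).
have [x x1 xs] : exists2 x, dot x x = 1 & forall y, y \in s -> dot x y = 0.
  by apply: exists_unit_orthogonal; rewrite sn.
by exists (rcons s x); [rewrite size_rcons sn | exact: orthonormal_rcons].
Qed.

Lemma orthonormal_basis s : orthonormal dot s -> size s = \dim {:V} ->
  basis_of fullv s.
Proof. by move=> os sV; rewrite basisEfree orthonormal_free// subvf sV leqnn. Qed.

Lemma coord_orthonormal n (b : n.-tuple V) i x :
  orthonormal dot b -> n = \dim {:V} -> coord b i x = dot x b`_i.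
Proof.
move=> ob nV.
have bb : basis_of fullv b by apply: orthonormal_basis => //; rewrite size_tuple.
rewrite {2}(coord_basis bb (memvf x)) dot_suml (bigD1 i)//= big1 => [|j ji].
  by rewrite dotZl nth_orthonormal ?size_tuple// eqxx mulr1 addr0.
by rewrite dotZl nth_orthonormal ?size_tuple// (inj_eq val_inj) (negPf ji) mulr0.
Qed.

Section Expansion.
Variable e : seq V.
Hypotheses (oe : orthonormal dot e) (eV : size e = \dim {:V}).

Lemma orthonormal_expand x : x = \sum_(i < size e) dot x e`_i *: e`_i.
Proof.
have eb : basis_of fullv (in_tuple e) by exact: orthonormal_basis.
rewrite {1}(coord_basis eb (memvf x)); apply: eq_bigr => i _.
by rewrite coord_orthonormal.
Qed.

Lemma dot_expand x y : dot x y = \sum_(i < size e) dot x e`_i * dot y e`_i.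
Proof.
rewrite {1}(orthonormal_expand x) dot_suml.
by apply: eq_bigr => i _; rewrite dotZl (dotC _ y).
Qed.

End Expansion.

(** The linear map taking one orthonormal basis to another preserves
    coordinates, hence inner products. *)
Lemma exists_isometry e e' : orthonormal dot e -> orthonormal dot e' ->
    size e = \dim {:V} -> size e' = \dim {:V} ->
  exists g : 'End(V),
    [/\ bijective g, forall u v, dot (g u) (g v) = dot u v
      & forall i, (i < size e)%N -> g e`_i = e'`_i].
Proof.
move=> oe oe' eV e'V; have see' : size e' = size e by rewrite eV e'V.
pose f x := \sum_(i < size e) dot x e`_i *: e'`_i.
have f_lin : linear f.
  move=> a x y; rewrite /f scaler_sumr -big_split; apply: eq_bigr => i _.
  by rewrite dotDl dotZl scalerDl scalerA.
pose fL := GRing.isLinear.Build _ _ _ _ f f_lin.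
pose g := linfun (HB.pack f fL : {linear V -> V}).
have gE x i : (i < size e)%N -> dot (g x) e'`_i = dot x e`_i.
  move=> ie; rewrite lfunE dot_suml (bigD1 (Ordinal ie))//= big1 => [|j ji].
    by rewrite dotZl nth_orthonormal ?see'// eqxx mulr1 addr0.
  rewrite dotZl nth_orthonormal ?see'//.
  by rewrite (_ : (j == i :> nat) = (j == Ordinal ie)) // (negPf ji) mulr0.
have g_iso u v : dot (g u) (g v) = dot u v.
  rewrite (dot_expand oe' e'V) [RHS](dot_expand oe eV) see'.
  by apply: eq_bigr => i _; rewrite !gE.
exists g; split=> //.
  have g0 : lker g == 0%VS.
    apply/lker0P => u v guv; apply: dot_inj => w.
    by rewrite -[LHS]g_iso -[RHS]g_iso guv.
  by exists (g^-1)%VF; [exact: lker0_lfunK | exact: lker0_lfunVK].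
move=> i ie; apply: dot_inj => w.
rewrite (dot_expand oe' e'V) [RHS](dot_expand oe' e'V) see'.
by apply: eq_bigr => j _; rewrite gE// !nth_orthonormal ?see'.
Qed.

End InnerProduct.

(** * Identities for a cross product *)

(** Reduces a consequence of a single linear equation to an identity that holds
    in every commutative ring. *)
Lemma eq_sub_trans (R : zmodType) (a b x y : R) :
  a = b -> x - y = a - b -> x = y.
Proof. by move=> -> /eqP; rewrite subrr subr_eq0 => /eqP. Qed.

Section CrossProduct.
Variables (R : realType) (V : vectType R) (dot : {dot V for idfun}).
Variable cross : {bilinear V -> V -> V}.
Hypothesis crossP : is_cross_product dot cross.
Implicit Types (u v w x y e f : V).

Lemma crossDl u v w : cross (u + v) w = cross u w + cross v w.
Proof. exact: linearDl. Qed.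

Lemma crossDr u v w : cross u (v + w) = cross u v + cross u w.
Proof. exact: linearDr. Qed.

Lemma crossNl u v : cross (- u) v = - cross u v.
Proof. exact: linearNl. Qed.

Lemma crossNr u v : cross u (- v) = - cross u v.
Proof. exact: linearNr. Qed.

Lemma crossZl (a : R) u v : cross (a *: u) v = a *: cross u v.
Proof. exact: linearZl_LR. Qed.

Lemma crossZr (a : R) u v : cross u (a *: v) = a *: cross u v.
Proof. exact: linearZr_LR. Qed.

Lemma cross_suml I r (P : pred I) (F : I -> V) v :
  cross (\sum_(i <- r | P i) F i) v = \sum_(i <- r | P i) cross (F i) v.
Proof. exact: linear_sumlz. Qed.

Lemma cross_sumr I r (P : pred I) (F : I -> V) v :
  cross v (\sum_(i <- r | P i) F i) = \sum_(i <- r | P i) cross v (F i).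
Proof. exact: linear_sumr. Qed.

Lemma crossC u v : cross u v = - cross v u.
Proof. by case: crossP => + _ _; apply. Qed.

Lemma dot_crossl u v : dot (cross u v) u = 0.
Proof. by case: crossP => _ /(_ u v)[]. Qed.

Lemma dot_crossr u v : dot (cross u v) v = 0.
Proof. by case: crossP => _ /(_ u v)[]. Qed.

Lemma dot_cross_cross u v :
  dot (cross u v) (cross u v) = dot u u * dot v v - dot u v ^+ 2.
Proof. by case: crossP => _ _ /(_ u v); rewrite !sqr_dot_norm. Qed.

Lemma crossvv u : cross u u = 0.
Proof. by apply/eqP; rewrite -(dot_eq0 dot) dot_cross_cross expr2 subrr. Qed.

Lemma dot_cross_swap u v w : dot (cross u v) w = - dot (cross u w) v.
Proof.
have := dot_crossr u (v + w).
rewrite crossDr dotDl !dotDr !dot_crossr add0r addr0 => /eqP.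
by rewrite addr_eq0 => /eqP.
Qed.

Lemma dot_cross_rot u v w : dot (cross u v) w = dot (cross v w) u.
Proof. by rewrite crossC dotNl dot_cross_swap opprK. Qed.

Lemma dot_cross_crossr u v w :
  dot (cross u v) (cross u w) = dot u u * dot v w - dot u v * dot u w.
Proof.
have := dot_cross_cross u (v + w).
rewrite crossDr !(dotDl, dotDr) !dot_cross_cross.
rewrite (dotC _ (cross u w) (cross u v)) (dotC _ w v) => E.
by apply: (@mulIf _ 2); [rewrite pnatr_eq0 | apply: eq_sub_trans E _; ring].
Qed.

(** The operator u × _ is skew-adjoint by [dot_cross_swap], so that its square is
    read off from the norm identity polarized in v. *)
Lemma cross_cross u v : cross u (cross u v) = dot u v *: u - dot u u *: v.
Proof.
apply: (@dot_inj _ _ dot) => w.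
rewrite dot_cross_swap (dotC _ (cross u w)) dot_cross_crossr dotBl !dotZl.
by rewrite opprB.
Qed.

(** Polarization of [cross_cross] in u: a Clifford relation with correction terms
    that vanish when u, v and w are orthogonal. *)
Lemma cross_cross_sym u v w :
  cross u (cross v w) + cross v (cross u w) =
    dot u w *: v + dot v w *: u - (dot u v *+ 2) *: w.
Proof.
apply: (@dot_inj _ _ dot) => x; have := congr1 (dot^~ x) (cross_cross (u + v) w).
rewrite !(crossDl, crossDr) !cross_cross /= !(dotDl, dotDr, dotNl, dotZl).
rewrite (dotC _ v u) mulr2n => E.
by apply: eq_sub_trans E _; ring.
Qed.

(** With [crossC], this makes u × (v × w) alternating on orthogonal triples, in
    place of the associativity that a cross product lacks. *)
Lemma crossCA u v w : dot u v = 0 -> dot u w = 0 -> dot v w = 0 ->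
  cross u (cross v w) = - cross v (cross u w).
Proof.
move=> uv uw vw; apply/eqP; rewrite -addr_eq0 cross_cross_sym uv uw vw.
by rewrite mul0rn !scale0r addr0 subrr.
Qed.

(** A dependency is killed by pairing it with u × v, then multiplying it by u and
    by v. *)
Lemma cross_free u v : cross u v != 0 -> free [:: u; v; cross u v].
Proof.
move=> uv0; apply/(@freeP _ _ 3 [tuple u; v; cross u v]) => k.
rewrite !big_ord_recl big_ord0 /= addr0 => kE.
have k2 : k (lift ord0 (lift ord0 ord0)) = 0.
  have /eqP := congr1 (dot^~ (cross u v)) kE.
  rewrite !(dotDl, dotZl) dot0l (dotC _ u) (dotC _ v) dot_crossl dot_crossr.
  by rewrite !mulr0 !add0r mulf_eq0 dot_eq0 (negPf uv0) orbF => /eqP.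
have k0 : k ord0 = 0.
  have /eqP := congr1 (cross^~ v) kE.
  rewrite k2 !(crossDl, crossZl) crossvv scaler0 scale0r !addr0 linear0l.
  by rewrite scaler_eq0 (negPf uv0) orbF => /eqP.
have k1 : k (lift ord0 ord0) = 0.
  have /eqP := congr1 (cross u) kE.
  rewrite k2 k0 !(crossDr, crossZr) !scale0r addr0 add0r linear0r.
  by rewrite scaler_eq0 (negPf uv0) orbF => /eqP.
case=> -[|[|[|//]]] lti; [move: k0 | move: k1 | move: k2];
  by apply: etrans; congr k; apply: val_inj.
Qed.

Lemma cross_neq0 u v : free [:: u; v] -> cross u v != 0.
Proof.
rewrite free_cons span_seq1 seq1_free => /andP[uv v0].
apply: contra uv => /eqP uv0; apply/vlineP.
exists (dot v u / dot v v); apply: (scalerI (a := dot v v)).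
  by rewrite dot_eq0.
rewrite scalerA mulrCA mulfV ?dot_eq0// mulr1; apply/eqP.
by rewrite eq_sym -subr_eq0 -cross_cross (crossC v u) uv0 oppr0 linear0r.
Qed.

(** * Frames and the dimension *)

Lemma orthonormal_cross u v : orthonormal dot [:: u; v] ->
  orthonormal dot [:: u; v; cross u v].
Proof.
move=> ouv; apply: (@orthonormal_rcons _ _ _ [:: u; v]) => //.
  rewrite dot_cross_cross (nth_orthonormal (i := 0) (j := 0) ouv)//.
  rewrite (nth_orthonormal (i := 1) (j := 1) ouv)//.
  by rewrite (nth_orthonormal (i := 0) (j := 1) ouv)// expr0n subr0 mulr1.
by move=> y /[!inE] /orP[]/eqP->; rewrite ?dot_crossl ?dot_crossr.
Qed.

Lemma exists_quaternion_frame : (1 < \dim {: V})%N ->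
  exists i j, orthonormal dot [:: i; j; cross i j].
Proof.
case/(exists_orthonormal dot) => -[|i [|j [|//]]] // _ oij.
by exists i, j; apply: orthonormal_cross.
Qed.

(** The doubling step that leads from the imaginary quaternions to the imaginary
    octonions; here e is meant to be a unit vector orthogonal to s. *)
Definition cayley_dickson (s : seq V) e := s ++ e :: map (cross e) s.

(** The vector e × x is orthogonal to y because its inner product with y is that
    of e with x × y; this is where e has to be orthogonal to the products. *)
Lemma orthonormal_cayley_dickson s e : orthonormal dot s -> dot e e = 1 ->
  (forall x, x \in s -> dot e x = 0) ->
  (forall x y, x \in s -> y \in s -> dot e (cross x y) = 0) ->
  orthonormal dot (cayley_dickson s e).
Proof.
move=> os e1 es exy.
rewrite /cayley_dickson -cat1s; apply: orthonormal_cat => //.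
  apply: orthonormal_cat.
  - by rewrite /orthonormal /= e1 eqxx.
  - rewrite orthonormal_map// => x y xs ys.
    by rewrite dot_cross_crossr e1 !es// mul1r mul0r subr0.
  by move=> _ _ /[!inE] /eqP -> /mapP[x xs ->]; rewrite dotC dot_crossl.
move=> x y xs; rewrite inE => /orP[/eqP->|/mapP[z zs ->]].
  by rewrite dotC es.
by rewrite dotC dot_cross_rot dotC exy.
Qed.

(** Doubling once more is impossible because the octonions are not associative:
    (f × i) × (e × j) can be brought to the form f × (e × k) by moving either
    factor, and the two results have opposite signs. *)
Lemma no_octonion_extension i j e f :
  orthonormal dot (cayley_dickson [:: i; j; cross i j] e) -> dot f f = 1 ->
  (forall x, x \in cayley_dickson [:: i; j; cross i j] e -> dot f x = 0) -> False.
Proof.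
set k := cross i j => os f1 fs.
have d m n := @nth_orthonormal _ _ _ _ m n os.
have dij : dot i j = 0 by have := d 0%N 1%N; apply.
have die : dot i e = 0 by have := d 0%N 3%N; apply.
have dej : dot e j = 0 by have := d 3%N 1%N; apply.
have dek : dot e k = 0 by have := d 3%N 2%N; apply.
have dee : dot e e = 1 by have := d 3%N 3%N; apply.
have dkk : dot k k = 1 by have := d 2%N 2%N; apply.
have dfi : dot f i = 0 by apply: fs; rewrite !inE eqxx ?orbT.
have dfj : dot f j = 0 by apply: fs; rewrite !inE eqxx ?orbT.
have dfk : dot f k = 0 by apply: fs; rewrite !inE eqxx ?orbT.
have dfe : dot f e = 0 by apply: fs; rewrite !inE eqxx ?orbT.
have dfei : dot f (cross e i) = 0 by apply: fs; rewrite !inE eqxx ?orbT.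
have dfej : dot f (cross e j) = 0 by apply: fs; rewrite !inE eqxx ?orbT.
have dfek : dot f (cross e k) = 0 by apply: fs; rewrite !inE eqxx ?orbT.
(* Here e × j moves inside f × i. *)
have way1 : cross (cross f i) (cross e j) = cross f (cross e k).
  rewrite crossC crossCA ?opprK; last 3 first.
  - by rewrite dotC.
  - by rewrite dot_cross_rot crossC dotNl dotC dek oppr0.
  - by [].
  by rewrite (crossC _ i) (crossCA (u := i))// opprK.
(* Here f × i moves inside e × j. *)
have way2 : cross (cross f i) (cross e j) = - cross f (cross e k).
  rewrite crossCA; last 3 first.
  - by rewrite dot_cross_rot crossC dotNl dotC dfei oppr0.
  - by rewrite dot_cross_rot dotC.
  - by [].
  rewrite (crossC _ j) crossNr opprK (crossCA (u := j))//; last first.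
    by rewrite dotC.
    by rewrite dotC.
  by rewrite (crossC j i) !crossNr opprK crossCA// dotC.
have : dot (cross f (cross e k)) (cross f (cross e k)) = 1.
  rewrite dot_cross_crossr f1 dfek dot_cross_crossr dee dkk dek.
  by rewrite !mulr0 !subr0 !mul1r.
have -> : cross f (cross e k) = 0.
  by apply/eqP; rewrite -(dot_eq0 dot) -eqNr -dotNl -way2 way1.
by rewrite dot0l => /esym/eqP; rewrite oner_eq0.
Qed.

Lemma exists_octonion_frame : (3 < \dim {: V})%N ->
  exists i j e, orthonormal dot (cayley_dickson [:: i; j; cross i j] e).
Proof.
move=> V3; have [i [j os]] := exists_quaternion_frame (ltn_trans (isT : 1 < 3)%N V3).
have [e e1 es] := @exists_unit_orthogonal _ _ dot [:: i; j; cross i j] V3.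
exists i, j, e; apply: orthonormal_cayley_dickson => //.
have d m n := @nth_orthonormal _ _ _ _ m n os.
have dij : dot i j = 0 by have := d 0%N 1%N; apply.
have dii : dot i i = 1 by have := d 0%N 0%N; apply.
have djj : dot j j = 1 by have := d 1%N 1%N; apply.
have ei : dot e i = 0 by apply: es; rewrite !inE eqxx ?orbT.
have ej : dot e j = 0 by apply: es; rewrite !inE eqxx ?orbT.
have ek : dot e (cross i j) = 0 by apply: es; rewrite !inE eqxx ?orbT.
have kj : cross i (cross i j) = - j.
  by rewrite cross_cross dij dii scale0r sub0r scale1r.
have ki : cross j (cross i j) = i.
  rewrite (crossC i) crossNr cross_cross (dotC _ j) dij djj.
  by rewrite scale0r sub0r scale1r opprK.
(* A product of two members of the frame is 0 or a member up to sign. *)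
move=> x y /[!inE] /or3P[]/eqP-> /or3P[]/eqP->;
  rewrite ?crossvv ?(linear0r dot)// ?(crossC (cross i j)) ?(crossC j i);
  by rewrite ?dotNr ?kj ?ki ?dotNr ?ek ?ei ?ej ?oppr0.
Qed.

Lemma cross_dim : \dim {: V} \in [:: 0; 1; 3; 7]%N.
Proof.
case: (ltnP 1 (\dim {: V})) => [V1|]; last by case: (\dim _) => [|[|]].
have [i [j /orthonormal_free/free_size_leq]] := exists_quaternion_frame V1.
rewrite leq_eqVlt => /orP[/eqP<-//|V3].
have [i' [j' [e os]]] := exists_octonion_frame V3.
move: (free_size_leq (orthonormal_free os)).
rewrite leq_eqVlt => /orP[/eqP<-//|V7].
have [f f1 fs] := exists_unit_orthogonal dot V7.
by case: (no_octonion_extension os f1 fs).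
Qed.

End CrossProduct.

(** * Products along oriented lines *)

(** A triple (i, j, k) stands for the product e_i × e_j = e_k, which entails the
    products for its cyclic rotations. *)
Definition rotations (T : seq (nat * nat * nat)) : seq (nat * nat * nat) :=
  flatten [seq [:: (t.1.1, t.1.2, t.2); (t.1.2, t.2, t.1.1);
                   (t.2, t.1.1, t.1.2)] | t <- T].

(** A Steiner triple system (any two distinct points lie on a line) whose lines
    carry a cyclic order; boolean, so that concrete systems are checked by
    evaluation. *)
Definition oriented_steiner (n : nat) (T : seq (nat * nat * nat)) : bool :=
  all (fun t => [&& t.1.1 < n, t.1.2 < n, t.2 < n & t.1.1 != t.1.2]%N) T &&
  all (fun p => all (fun q => (p == q) ||
         has (fun k => ((p, q, k) \in rotations T) || ((q, p, k) \in rotations T))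
           (iota 0 n)) (iota 0 n)) (iota 0 n).

Definition quaternion_lines : seq (nat * nat * nat) := [:: (0, 1, 2)]%N.

(** The Fano plane, oriented as dictated by [cayley_dickson]: the numbers 0, 1, 2,
    3 stand for i, j, i × j, e and 4 + a stands for the product of e with the
    vector numbered a. *)
Definition octonion_lines : seq (nat * nat * nat) :=
  [:: (0, 1, 2); (3, 0, 4); (3, 1, 5); (3, 2, 6);
      (1, 4, 6); (5, 0, 6); (4, 2, 5)]%N.

Definition follows (R : realType) (V : vectType R) (cross : V -> V -> V)
    (T : seq (nat * nat * nat)) (e : seq V) : Prop :=
  forall i j k, (i, j, k) \in T -> cross e`_i e`_j = e`_k.

Section Uniqueness.
Variables (R : realType) (V : vectType R) (dot : {dot V for idfun}).
Implicit Types (cross : {bilinear V -> V -> V}) (e s : seq V).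

(** If v is a unit vector orthogonal to u then v × (u × v) = u, so that each line
    may be started at its second point. *)
Lemma follows_rotations cross n T e : is_cross_product dot cross ->
  oriented_steiner n T -> orthonormal dot e -> size e = n ->
  follows cross T e -> follows cross (rotations T) e.
Proof.
move=> crossP /andP[/allP Tn _] oe en eT.
have rot u v : dot u v = 0 -> dot v v = 1 -> cross v (cross u v) = u.
  move=> uv vv; rewrite (crossC crossP u) crossNr (cross_cross crossP) (dotC _ v).
  by rewrite uv vv scale0r sub0r scale1r opprK.
move=> i j k /flatten_mapP[[[a b] c]] Tabc.
have /= /and4P[an bn cn ab] := Tn _ Tabc; have abc := eT _ _ _ Tabc.
have eab : dot e`_a e`_b = 0 by rewrite nth_orthonormal ?en// (negPf ab).
have ebc : dot e`_b e`_c = 0 by rewrite -abc dotC (dot_crossr crossP).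
have bca : cross e`_b e`_c = e`_a by rewrite -abc rot// nth_orthonormal ?en// eqxx.
rewrite !inE => /or3P[] /eqP[-> -> ->] //.
by rewrite -bca rot// nth_orthonormal ?en// eqxx.
Qed.

(** By bilinearity it suffices to compare products of distinct basis vectors, and
    two such vectors lie on a common line in one of its two orders. *)
Lemma cross_transfer cross cross' n T e e' (g : 'End(V)) :
    is_cross_product dot cross -> is_cross_product dot cross' ->
    oriented_steiner n T -> n = \dim {: V} ->
    orthonormal dot e -> size e = n -> follows cross T e ->
    orthonormal dot e' -> size e' = n -> follows cross' T e' ->
    (forall i, (i < n)%N -> g e`_i = e'`_i) ->
  forall u v, g (cross u v) = cross' (g u) (g v).
Proof.
move=> cP cP' TS nV oe en eT oe' en' eT' ge u v.
have rT := follows_rotations cP TS oe en eT.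
have rT' := follows_rotations cP' TS oe' en' eT'.
have gE p q : (p < n)%N -> (q < n)%N ->
    g (cross e`_p e`_q) = cross' (g e`_p) (g e`_q).
  have mem_n r : (r < n)%N -> r \in iota 0 n by rewrite mem_iota.
  move=> pn qn; rewrite (ge _ pn) (ge _ qn).
  have /andP[_ /allP/(_ _ (mem_n _ pn))/allP/(_ _ (mem_n _ qn))] := TS.
  case/orP=> [/eqP->|/hasP[k]]; first by rewrite !(@crossvv _ _ dot)// linear0.
  rewrite mem_iota /= add0n => kn /orP[] pqk.
    by rewrite (rT _ _ _ pqk) (rT' _ _ _ pqk) ge.
  rewrite (crossC cP) (crossC cP') linearN (rT _ _ _ pqk) (rT' _ _ _ pqk).
  by rewrite /= ge.
have eV : size e = \dim {: V} by rewrite en.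
rewrite (orthonormal_expand oe eV u) (orthonormal_expand oe eV v).
rewrite (cross_suml cross) !(linear_sum g) /= (cross_suml cross').
apply: eq_bigr => p _.
rewrite (cross_sumr cross) (cross_sumr cross') (linear_sum g) /=.
apply: eq_bigr => q _.
have gZ a x : g (a *: x) = a *: g x by exact: linearZ_LR.
rewrite !(gZ, crossZl, crossZr) gE//.
  by rewrite -en.
by rewrite -en.
Qed.

(** The line i, j, i × j and the three lines through e hold by construction; on
    the other three, [crossCA] moves e to the front of the product. *)
Lemma octonion_frame_follows cross (i j e : V) : is_cross_product dot cross ->
  orthonormal dot (cayley_dickson cross [:: i; j; cross i j] e) ->
  follows cross octonion_lines (cayley_dickson cross [:: i; j; cross i j] e).
Proof.
set k := cross i j => crossP os.
have d m n := @nth_orthonormal _ _ _ _ m n os.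
have dij : dot i j = 0 by have := d 0%N 1%N; apply.
have dik : dot i k = 0 by have := d 0%N 2%N; apply.
have die : dot i e = 0 by have := d 0%N 3%N; apply.
have dej : dot e j = 0 by have := d 3%N 1%N; apply.
have dek : dot e k = 0 by have := d 3%N 2%N; apply.
have djj : dot j j = 1 by have := d 1%N 1%N; apply.
have dii : dot i i = 1 by have := d 0%N 0%N; apply.
have ki : cross k i = j.
  rewrite (crossC crossP) (cross_cross crossP) dij dii scale0r scale1r.
  by rewrite sub0r opprK.
move=> a b c; rewrite !inE => /or4P[|||/or4P[]] /eqP[-> -> ->] //=.
- rewrite (crossCA crossP) ?(crossC crossP j) ?crossNr ?opprK//; by rewrite dotC.
- by rewrite (crossC crossP) (crossCA crossP)// ?opprK// dotC.
by rewrite (crossC crossP) (crossCA crossP) ?ki ?opprK//; rewrite dotC.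
Qed.

Lemma cross7_unique cross cross' : \dim {: V} = 7%N ->
    is_cross_product dot cross -> is_cross_product dot cross' ->
  exists g : 'End(V),
    [/\ bijective g, forall u v, dot (g u) (g v) = dot u v
      & forall u v, g (cross u v) = cross' (g u) (g v)].
Proof.
move=> V7 cP cP'; have V3 : (3 < \dim {: V})%N by rewrite V7.
have [i [j [e os]]] := exists_octonion_frame cP V3.
have [i' [j' [e' os']]] := exists_octonion_frame cP' V3.
have [g [g_bij g_iso gE]] := exists_isometry os os' (esym V7) (esym V7).
exists g; split=> //.
apply: (cross_transfer (T := octonion_lines) cP cP' _ (esym V7)
  os _ _ os' _ _ gE) => //.
  exact: octonion_frame_follows.
exact: octonion_frame_follows.
Qed.

Lemma quaternion_frame_follows cross i j :
  follows cross quaternion_lines [:: i; j; cross i j].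
Proof. by move=> a b c /[!inE] /eqP[-> -> ->]. Qed.

(** Since cross' i j is a unit vector orthogonal to i and j, it is cross i j up to
    sign. *)
Lemma cross3_unique cross cross' : \dim {: V} = 3%N ->
    is_cross_product dot cross -> is_cross_product dot cross' ->
  (forall u v, cross' u v = cross u v) \/ (forall u v, cross' u v = - cross u v).
Proof.
move=> V3 cP cP'; have V1 : (1 < \dim {: V})%N by rewrite V3.
have [i [j]] := exists_quaternion_frame cP V1.
have eT := quaternion_frame_follows cross i j.
move: eT; set e := [:: i; j; cross i j] => eT oe.
have d m n := @nth_orthonormal _ _ _ _ m n oe.
have dij : dot i j = 0 by have := d 0%N 1%N; apply.
have dii : dot i i = 1 by have := d 0%N 0%N; apply.
have djj : dot j j = 1 by have := d 1%N 1%N; apply.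
have dkk : dot (cross i j) (cross i j) = 1 by have := d 2%N 2%N; apply.
pose s := dot (cross' i j) (cross i j).
have xE : cross' i j = s *: cross i j.
  rewrite {1}(orthonormal_expand oe (esym V3) (cross' i j)).
  rewrite !big_ord_recl big_ord0 /= (dot_crossl cP') (dot_crossr cP').
  by rewrite !scale0r !add0r addr0.
have : s ^+ 2 = 1.
  have := dot_cross_cross cP' i j.
  rewrite xE dotZl dotZr dkk mulr1 -expr2 => ->.
  by rewrite dii djj dij expr0n subr0 mulr1.
move/eqP; rewrite sqrf_eq1 => /orP[] /eqP s1; rewrite s1 in xE; [left|right] => u v.
  have := @cross_transfer _ _ 3 quaternion_lines e e \1%VF cP cP' isT (esym V3)
    oe erefl eT oe erefl _ _ u v.
  rewrite !id_lfunE => -> //; last by move=> ? _; rewrite id_lfunE.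
  by move=> a b c /[!inE] /eqP[-> -> ->] /=; rewrite xE scale1r.
(* If cross' i j = - cross i j then cross' follows the opposite frame, so that
   the linear map to use is -1. *)
have oe' : orthonormal dot (map -%R e).
  by rewrite orthonormal_map// => x y _ _; rewrite dotNl dotNr opprK.
have := @cross_transfer _ _ 3 quaternion_lines e (map -%R e) (- \1%VF) cP cP' isT
  (esym V3) oe erefl eT oe' erefl _ _ u v.
rewrite !opp_lfunE !id_lfunE crossNl crossNr opprK => -> //.
  move=> a b c /[!inE] /eqP[-> -> ->] /=.
  by rewrite crossNl crossNr opprK xE scaleN1r.
by case=> [|[|[|//]]] _; rewrite opp_lfunE id_lfunE.
Qed.

End Uniqueness.

(** * Existence *)

(** The rotations of T are the structure constants, with (i, j, k)
    contributing the 2 x 2 minor of a and b on the indices i, j to the k-th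
    coordinate of their product. *)
Definition table_coord (R : realType) (T : seq (nat * nat * nat))
    (a b : nat -> R) (m : nat) : R :=
  \sum_(t <- rotations T | t.2 == m)
    (a t.1.1 * b t.1.2 - a t.1.2 * b t.1.1).

(** The axioms of a cross product read in coordinates: the product of a and b is
    orthogonal to a and satisfies the norm identity. *)
Definition normed_table (R : realType) (n : nat) (T : seq (nat * nat * nat)) :=
  forall a b : nat -> R,
    \sum_(0 <= m < n) table_coord T a b m * a m = 0 /\
    \sum_(0 <= m < n) table_coord T a b m * table_coord T a b m =
      (\sum_(0 <= m < n) a m * a m) * (\sum_(0 <= m < n) b m * b m)
        - (\sum_(0 <= m < n) a m * b m) ^+ 2.

(* Unfolds the sums over a concrete table, then compares coefficients; the inner
   sums come last because their filter computes only at a numeral m. *)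
Ltac compute_table :=
  move=> a b; rewrite /index_iota subn0 !unlock;
  cbn -[table_coord GRing.add GRing.mul GRing.opp GRing.zero GRing.exp];
  rewrite /table_coord ?unlock;
  cbn -[GRing.add GRing.mul GRing.opp GRing.zero GRing.exp];
  split; ring.

Lemma normed_table0 (R : realType) : normed_table R 0 [::].
Proof. by compute_table. Qed.

Lemma normed_table1 (R : realType) : normed_table R 1 [::].
Proof. by compute_table. Qed.

Lemma normed_table3 (R : realType) : normed_table R 3 quaternion_lines.
Proof. by compute_table. Qed.

Lemma normed_table7 (R : realType) : normed_table R 7 octonion_lines.
Proof. by compute_table. Qed.

Section Existence.
Variables (R : realType) (V : vectType R) (dot : {dot V for idfun}).
Variables (T : seq (nat * nat * nat)) (e : seq V).

Definition table_cross (u v : V) : V :=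
  \sum_(t <- rotations T)
    (dot u e`_t.1.1 * dot v e`_t.1.2 - dot u e`_t.1.2 * dot v e`_t.1.1)
      *: e`_t.2.

Lemma table_cross_bilinear : bilinear_for *:%R *:%R table_cross.
Proof.
split=> [v|u] a x y /=; rewrite /table_cross scaler_sumr -big_split;
  apply: eq_bigr => t _ /=; rewrite !(dotDl, dotZl) scalerA -scalerDl;
  by congr (_ *: _); ring.
Qed.

HB.instance Definition _ :=
  bilinear_isBilinear.Build R V V V *:%R *:%R table_cross table_cross_bilinear.

Hypotheses (oe : orthonormal dot e) (eV : size e = \dim {: V}).

Lemma dot_table_cross u v m : (m < size e)%N ->
  dot (table_cross u v) e`_m =
    table_coord T (fun i => dot u e`_i) (fun i => dot v e`_i) m.
Proof.
move=> me; rewrite dot_suml /table_coord [RHS]big_mkcond.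
apply: eq_bigr => t _; rewrite dotZl; have [te|et] := ltnP t.2 (size e).
  by rewrite nth_orthonormal//; case: eqP => _; rewrite ?mulr1 ?mulr0.
(* An index of T beyond the basis denotes the zero vector. *)
rewrite (nth_default _ et) dot0l mulr0; case: eqP => // tm.
by rewrite -tm ltnNge et in me.
Qed.

Lemma table_crossP : normed_table R (size e) T ->
  is_cross_product dot table_cross.
Proof.
move=> eT.
have skew u v : table_cross u v = - table_cross v u.
  rewrite -sumrN; apply: eq_bigr => t _; rewrite -scaleNr; congr (_ *: _); ring.
have orth u v : dot (table_cross u v) u = 0.
  apply: etrans (eT (fun i => dot u e`_i) (fun i => dot v e`_i)).1.
  rewrite (dot_expand oe eV) big_mkord.
  by apply: eq_bigr => m _; rewrite dot_table_cross.
have orth' u v : dot (table_cross u v) v = 0 by rewrite skew dotNl orth oppr0.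
split=> [|u v|u v]; [exact: skew | by split; [exact: orth | exact: orth'] |].
rewrite !sqr_dot_norm !(dot_expand oe eV).
have := (eT (fun i => dot u e`_i) (fun i => dot v e`_i)).2.
rewrite !big_mkord => <-.
by apply: eq_bigr => m _; rewrite dot_table_cross.
Qed.

End Existence.

Lemma exists_cross (R : realType) (V : vectType R) (dot : {dot V for idfun}) :
  \dim {: V} \in [:: 0; 1; 3; 7]%N ->
  exists cross : {bilinear V -> V -> V}, is_cross_product dot cross.
Proof.
move=> V0137; have [e eV oe] := exists_orthonormal dot (leqnn (\dim {: V})).
have [T eT] : exists T, normed_table R (size e) T.
  rewrite eV; move: V0137; rewrite !inE => /or4P[] /eqP->.
  - by exists [::]; exact: normed_table0.
  - by exists [::]; exact: normed_table1.
  - by exists quaternion_lines; exact: normed_table3.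
  - by exists octonion_lines; exact: normed_table7.
by exists (table_cross dot T e); apply: table_crossP.
Qed.

(** * Orientation in dimension 3 *)

Section Orientation.
Variables (R : realType) (V : vectType R) (dot : {dot V for idfun}).
Implicit Types (cross : {bilinear V -> V -> V}) (u v w : V).

Lemma basis_changeM n (b e b' : n.-tuple V) : basis_of fullv e ->
  basis_change b b' = basis_change e b' *m basis_change b e.
Proof.
move=> eb; apply/matrixP => j i; rewrite !mxE {1}(coord_basis eb (memvf (tnth b' j))).
rewrite linear_sum; apply: eq_bigr => k _ /=.
by rewrite linearZ !mxE (tnth_nth 0 e).
Qed.

Lemma basis_change_id n (e : n.-tuple V) :
  basis_of fullv e -> basis_change e e = 1%:M.
Proof.
move=> /basis_free ef; apply/matrixP => j i.
by rewrite !mxE (tnth_nth 0) coord_free// eq_sym.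
Qed.

Lemma det_basis_change_neq0 n (b e : n.-tuple V) :
  basis_of fullv b -> basis_of fullv e -> \det (basis_change b e) != 0.
Proof.
move=> bb eb; have := congr1 determinant (basis_changeM e e bb).
rewrite basis_change_id// det1 det_mulmx => /esym/eqP.
by apply: contraTneq => ->; rewrite mul0r eq_sym oner_eq0.
Qed.

Lemma det3E (A : 'M[R]_3) (f : nat -> nat -> R) :
    (forall i j : 'I_3, A i j = f i j) ->
  \det A = f 0%N 0%N * (f 1%N 1%N * f 2%N 2%N - f 1%N 2%N * f 2%N 1%N)
         - f 0%N 1%N * (f 1%N 0%N * f 2%N 2%N - f 1%N 2%N * f 2%N 0%N)
         + f 0%N 2%N * (f 1%N 0%N * f 2%N 1%N - f 1%N 1%N * f 2%N 0%N).
Proof.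
move=> Af; rewrite (expand_det_row _ ord0) !big_ord_recl big_ord0 /cofactor.
rewrite !(expand_det_row _ ord0) !big_ord_recl !big_ord0 /cofactor !det_mx11.
rewrite !mxE !Af /= /bump /=; ring.
Qed.

(** Both sides are alternating trilinear forms on a space of dimension 3, equal to
    1 on the frame; the proof compares them in coordinates. *)
Lemma det_basis_change_cross cross u v w i j : \dim {: V} = 3%N ->
    is_cross_product dot cross -> orthonormal dot [:: i; j; cross i j] ->
  \det (basis_change [tuple i; j; cross i j] [tuple u; v; w]) =
    dot (cross u v) w.
Proof.
move=> V3 cP; set k := cross i j => oe.
rewrite (@det3E _ (fun m n => dot [:: u; v; w]`_m [:: i; j; k]`_n)); last first.
  by move=> m n; rewrite mxE (coord_orthonormal _ _ oe)// (tnth_nth 0).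
have d m n := @nth_orthonormal _ _ _ _ m n oe.
have dij : dot i j = 0 by have := d 0%N 1%N; apply.
have dii : dot i i = 1 by have := d 0%N 0%N; apply.
have djj : dot j j = 1 by have := d 1%N 1%N; apply.
have ij : cross i j = k by [].
have ik : cross i k = - j.
  by rewrite (cross_cross cP) dij dii scale0r sub0r scale1r.
have jk : cross j k = i.
  rewrite /k (crossC cP i) crossNr (cross_cross cP) (dotC _ j) dij djj.
  by rewrite scale0r sub0r scale1r opprK.
have expand x : x = dot x i *: i + (dot x j *: j + dot x k *: k).
  rewrite {1}(orthonormal_expand oe (esym V3) x).
  by rewrite !big_ord_recl big_ord0 addr0.
rewrite [in RHS](expand u) [in RHS](expand v) !(crossDl, crossDr, crossZl, crossZr).
rewrite (crossC cP j i) (crossC cP k i) (crossC cP k j) ij ik jk !(crossvv cP).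
rewrite !(dotDl, dotZl, dotNl, dot0l) !(dotC _ _ w) /=; ring.
Qed.

(** The determinant of u, v, u × v in the basis b is the one of the frame times
    the square of the norm of u × v. *)
Lemma cross_induces b O cross i j : \dim {: V} = 3%N ->
    is_cross_product dot cross -> orthonormal dot [:: i; j; cross i j] ->
    (forall b' : 3.-tuple V,
       O b' <-> basis_of fullv b' /\ 0 < \det (basis_change b b')) ->
    0 < \det (basis_change b [tuple i; j; cross i j]) ->
  induces_cross O cross.
Proof.
move=> V3 cP oe OE be u v uv; have uv0 := cross_neq0 cP uv.
have eb : basis_of fullv [tuple i; j; cross i j].
  exact: orthonormal_basis oe (esym V3).
apply/OE; split.
  by rewrite basisEfree (cross_free cP uv0) subvf V3.
rewrite (basis_changeM _ _ eb) det_mulmx (det_basis_change_cross _ _ _ V3 cP oe).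
by rewrite mulr_gt0// dot_gt0.
Qed.

Lemma cross3_exists_orientation cross : \dim {: V} = 3%N ->
    is_cross_product dot cross ->
  exists2 O : set (3.-tuple V), is_orientation O & induces_cross O cross.
Proof.
move=> V3 cP; have V1 : (1 < \dim {: V})%N by rewrite V3.
have [i [j oe]] := exists_quaternion_frame cP V1.
pose e := [tuple i; j; cross i j].
have eb : basis_of fullv e by exact: orthonormal_basis oe (esym V3).
exists (fun b' : 3.-tuple V => basis_of fullv b' /\ 0 < \det (basis_change e b')).
  by exists e.
apply: (cross_induces (b := e) V3 cP oe) => //.
by rewrite basis_change_id// det1.
Qed.

Lemma exists_oriented_frame (b : 3.-tuple V) : basis_of fullv b ->
  exists i j k, orthonormal dot [:: i; j; k] /\
    0 < \det (basis_change b [tuple i; j; k]).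
Proof.
move=> bb; have V3 : \dim {: V} = 3%N by rewrite (size_basis bb).
have [[|i [|j [|k [|//]]]] // _ oe] := exists_orthonormal dot (eq_leq (esym V3)).
have eb : basis_of fullv [tuple i; j; k] by exact: orthonormal_basis oe (esym V3).
have := det_basis_change_neq0 bb eb.
rewrite neq_lt => /orP[be|be]; last by exists i, j, k.
(* In odd dimension the opposite frame has the opposite orientation. *)
exists (- i), (- j), (- k); split.
  have := @orthonormal_map _ _ dot -%R [:: i; j; k].
  by rewrite oe => ->// x y _ _; rewrite dotNl dotNr opprK.
have -> : basis_change b [tuple - i; - j; - k] = - 1 *: basis_change b [tuple i; j; k].
  apply/matrixP => m n; rewrite !mxE !(tnth_nth 0) mulN1r -linearN /=.
  by case: m => -[|[|[|//]]].
by rewrite detZ -signr_odd /= expr1 mulN1r oppr_gt0.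
Qed.

(** The cross product is the one of a positively oriented orthonormal frame; its
    opposite would make the basis i, j, -(i × j) positively oriented. *)
Lemma orientation_exists_cross (O : set (3.-tuple V)) :
    \dim {: V} = 3%N -> is_orientation O ->
  exists cross,
    [/\ is_cross_product dot cross, induces_cross O cross
      & forall cross', is_cross_product dot cross' -> induces_cross O cross' ->
          forall u v, cross' u v = cross u v].
Proof.
move=> V3 [b bb OE]; have [i [j [k [oe be]]]] := exists_oriented_frame bb.
pose cross : {bilinear V -> V -> V} := table_cross dot quaternion_lines [:: i; j; k].
have cP : is_cross_product dot cross.
  apply: table_crossP; [exact: oe | exact: esym V3 | exact: normed_table3].
have d m n := @nth_orthonormal _ _ _ _ m n oe.
have dii : dot i i = 1 by have := d 0%N 0%N; apply.
have djj : dot j j = 1 by have := d 1%N 1%N; apply.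
have dij : dot i j = 0 by have := d 0%N 1%N; apply.
have dik : dot i k = 0 by have := d 0%N 2%N; apply.
have djk : dot j k = 0 by have := d 1%N 2%N; apply.
have ijk : cross i j = k.
  rewrite /= /table_cross !big_cons big_nil /= dii djj dij dik djk.
  by rewrite !mul0r !mulr0 mul1r !subr0 scale1r !scale0r !addr0.
rewrite -ijk in oe be.
exists cross; split=> //; first exact: cross_induces V3 cP oe OE be.
move=> cross' cP' O'; have [//|ccN] := cross3_unique V3 cP cP'.
have ijf : free [:: i; j].
  exact: (@catl_free _ _ [:: cross i j] [:: i; j]) (orthonormal_free oe).
have [_] := (OE _).1 (O' i j ijf).
have eb : basis_of fullv [tuple i; j; cross i j].
  exact: orthonormal_basis oe (esym V3).
rewrite (basis_changeM _ _ eb) det_mulmx (det_basis_change_cross _ _ _ V3 cP oe).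
rewrite ccN dotNr (pmulr_lgt0 _ be) oppr_gt0.
by rewrite ltNge dot_ge0.
Qed.

End Orientation.

(** * The classification *)

Theorem theorem2p5 (R : realType) (V : vectType R) (dot : {dot V for idfun}) :
  [/\ (exists cross : {bilinear V -> V -> V}, is_cross_product dot cross)
        <-> \dim {: V} \in [:: 0; 1; 3; 7]%N,
      \dim {: V} = 0%N \/ \dim {: V} = 1%N ->
        forall cross : {bilinear V -> V -> V}, is_cross_product dot cross ->
          forall u v, cross u v = 0,
      \dim {: V} = 3%N ->
        [/\ forall cross cross' : {bilinear V -> V -> V},
              is_cross_product dot cross -> is_cross_product dot cross' ->
              (forall u v, cross' u v = cross u v)
              \/ (forall u v, cross' u v = - cross u v),
            forall O : set (3.-tuple V), is_orientation O ->
              exists cross : {bilinear V -> V -> V},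
                [/\ is_cross_product dot cross, induces_cross O cross &
                    forall cross' : {bilinear V -> V -> V},
                      is_cross_product dot cross' -> induces_cross O cross' ->
                      forall u v, cross' u v = cross u v]
          & forall cross : {bilinear V -> V -> V}, is_cross_product dot cross ->
              exists2 O : set (3.-tuple V),
                is_orientation O & induces_cross O cross]
    & \dim {: V} = 7%N ->
        forall cross cross' : {bilinear V -> V -> V},
          is_cross_product dot cross -> is_cross_product dot cross' ->
          exists g : 'End(V),
            [/\ bijective g,
                forall u v, dot (g u) (g v) = dot u v
              & forall u v, g (cross u v) = cross' (g u) (g v)]].
Proof.
split.
- split=> [[cross crossP]|]; last exact: exists_cross.
  exact: cross_dim crossP.
- move=> V01 cross cP u v; apply: contraTeq isT => uv0.
  by have := free_size_leq (cross_free cP uv0); case: V01 => ->.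
- move=> V3; split=> [cross cross'|O|cross].
  + exact: cross3_unique.
  + exact: orientation_exists_cross.
  + exact: cross3_exists_orientation.
by move=> V7 cross cross'; apply: cross7_unique.
Qed.
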